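(* Let $G$ be a finitely generated group. If $G$ is uniformly non-amenable, then the product replacement graph $\Gamma_n(G)$ is non-amenable for every $n \geq d(G)$.
   Context: Graphs: a graph $\Gamma=(V,E)$ is a possibly infinite undirected graph of bounded degree, possibly with loops and repeated edges (edges are counted with multiplicity); it need not be connected. Cheeger constant: for a nonempty graph $\Gamma$, $h(\Gamma)=\inf_X |\partial X|/|X|$, where $X$ runs over all nonempty finite sets of vertices and $\partial X$ is the set of edges between $X$ and its complement. $\Gamma$ is non-amenable if $h(\Gamma)>0$ (connectedness is not required). Product replacement graph: $d(G)$ is the minimum number of generators of $G$. $\Gamma_n(G)$ is the graph whose vertices are the $n$-tuples $S=(s_1,\dots,s_n)\in G^n$ with $G=\langle s_1,\dots,s_n\rangle$, with edges, for each pair $1\le i,j\le n$, $i\neq j$, and each sign, joining $(s_1,\dots,s_n)$ to the tuple obtained by replacing $s_j$ with $s_j s_i^{\pm1}$ and to the tuple obtained by replacing $s_j$ with $s_i^{\pm 1}s_j$ (all other entries unchanged). Cayley graph: for $S=(s_1,\dots,s_n)\in\Gamma_n(G)$, $\mathrm{Cay}(G,S)$ has vertex set $G$ and edges $g\leftrightarrow g s_i^{\pm1}$ for $1\le i\le n$, i.e. one edge joining $g$ and $gs_i$ for each $g\in G$ and each $i$. Write $h(G,S)=h(\mathrm{Cay}(G,S))$. Uniform non-amenability: $G$ is uniformly non-amenable if for every $n\ge d(G)$ there is a constant $h(G,n)>0$ such that $\inf_{S\in\Gamma_n(G)}h(G,S)>h(G,n)$. *)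

(* Defs.v *)
From mathcomp Require Import all_boot all_order all_algebra.
From mathcomp Require Import finmap.
From mathcomp Require Import boolp classical_sets functions cardinality reals.

Set Implicit Arguments.
Unset Strict Implicit.
Unset Printing Implicit Defensive.

Import Order.TTheory GRing.Theory Num.Theory.
Local Open Scope fset_scope.
Local Open Scope classical_set_scope.

(* Undirected multigraphs in the sense of Serre: an edge (possibly a loop, or
   parallel to other edges) is an orbit {e, rev e} of the reversal of oriented
   edges (darts), and its endpoints are [origin e] and [origin (rev e)]. *)
Record multigraph := Multigraph {
  vertex : choiceType;
  dart : choiceType;
  origin : dart -> vertex;
  rev : dart -> dart;
  revK : involutive rev;
  rev_neq : forall e, rev e != e;
  bounded_degree :
    exists D : nat, forall v, (origin @^-1` [set v] #<= `I_D)%card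
}.

(* Each edge between X and its complement has exactly one orientation leaving
   X; the boundary is represented by these orientations. *)
Definition boundary (Gam : multigraph) (X : {fset vertex Gam}) :
    set (dart Gam) :=
  [set e | origin e \in X /\ origin (rev e) \notin X].

Lemma boundary_finite (Gam : multigraph) (X : {fset vertex Gam}) :
  finite_set (boundary X).
Proof.
have [D degD] := bounded_degree Gam.
apply: (@sub_finite_set _ _ (\bigcup_(v in [set` X]) (@origin Gam @^-1` [set v]))).
  by move=> e [eX _]; exists (origin e).
apply: bigcup_finite => [|v _]; first exact: finite_fset.
by apply: card_le_finite (degD v) _; exact: finite_II.
Qed.

(* By [boundary_finite], [fset_set] does not hit its default value here; the
   infimum is over a set of reals bounded below by 0. *)
Definition cheeger (R : realType) (Gam : multigraph) : R :=
  (inf [set #|` fset_set (boundary X)|%:R / #|` X|%:R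
        | X in [set X : {fset vertex Gam} | X != fset0]])%R.

(* [inf set0 = 0], so an empty graph is not non-amenable. *)
Definition nonamenable (R : realType) (Gam : multigraph) : Prop :=
  (0 < cheeger R Gam)%R.

(* The graph whose edges are v -- step v l, where the edge labelled l at v is
   the edge labelled [linv l] at [step v l], traversed backwards. *)
Section LabelledGraph.
Variables (V : choiceType) (L : finType) (step : V -> L -> V) (linv : L -> L).
Hypotheses (linvK : involutive linv) (linv_neq : forall l, linv l != l).
Hypothesis stepK : forall v l, step (step v l) (linv l) = v.

Definition labelled_rev (e : V * L) : V * L := (step e.1 e.2, linv e.2).

Lemma labelled_revK : involutive labelled_rev.
Proof. by case=> v l; rewrite /labelled_rev /= stepK linvK. Qed.

Lemma labelled_rev_neq e : labelled_rev e != e.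
Proof. by case: e => v l; rewrite xpair_eqE negb_and linv_neq orbT. Qed.

Lemma labelled_bounded_degree :
  exists D : nat, forall v : V,
    ((fst : V * L -> V) @^-1` [set v] #<= `I_D)%card.
Proof.
exists #|L| => v.
have -> : (fst : V * L -> V) @^-1` [set v] = pair v @` [set: L].
  by apply/seteqP; split=> [[u l] /= ->|e [l _ <-]] //; exists l.
apply: card_le_trans (card_image_le _ _) _.
have -> : `I_#|L| = (fun l : L => nat_of_ord (enum_rank l)) @` [set: L].
  apply/seteqP; split=> [k /= ltk|k [l _ <-]]; last exact: ltn_ord.
  by exists (enum_val (Ordinal ltk)); rewrite ?enum_valK.
have injr : {in [set: L] &, injective (fun l : L => nat_of_ord (enum_rank l))}.
  by move=> l l' _ _ /ord_inj/enum_rank_inj.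
by have := inj_card_eq injr; rewrite card_eq_le => /andP[].
Qed.

Definition labelled_graph : multigraph :=
  @Multigraph V (V * L)%type fst labelled_rev
    labelled_revK labelled_rev_neq labelled_bounded_degree.
End LabelledGraph.

Section Generation.
Variable G : groupType.
Implicit Types n : nat.
Local Open Scope group_scope.

Definition generated (A : set G) : set G :=
  smallest [set H : set G | group_closed (mem H)] A.

Definition generates n (s : {ffun 'I_n -> G}) : Prop :=
  generated (range s) = [set: G].

Definition gen_tuple n : choiceType := {s : {ffun 'I_n -> G} | `[< generates s >]}.

Definition has_gen_tuple : pred nat :=
  fun n => `[< exists s : {ffun 'I_n -> G}, generates s >].

Definition finitely_generated : Prop := exists n, has_gen_tuple n.

Definition min_gens (fgG : finitely_generated) : nat := ex_minn fgG.

Definition signed (neg : bool) (x : G) : G := if neg then x^-1 else x.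

Lemma signedN b x : signed (~~ b) x = (signed b x)^-1.
Proof. by case: b; rewrite /signed /= ?invgK. Qed.

Definition flip_sign (T : Type) (l : T * bool) : T * bool := (l.1, ~~ l.2).

Lemma flip_signK T : involutive (@flip_sign T).
Proof. by case=> t b; rewrite /flip_sign /= negbK. Qed.

Lemma flip_sign_neq (T : eqType) (l : T * bool) : flip_sign l != l.
Proof. by case: l => t [] /=; rewrite xpair_eqE andbF. Qed.

Definition cayley_step n (s : {ffun 'I_n -> G}) (g : G) (l : 'I_n * bool) : G :=
  g * signed l.2 (s l.1).

Lemma cayley_stepK n (s : {ffun 'I_n -> G}) g l :
  cayley_step s (cayley_step s g l) (flip_sign l) = g.
Proof. by rewrite /cayley_step signedN mulgK. Qed.

Definition cayley n (s : {ffun 'I_n -> G}) : multigraph :=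
  labelled_graph (@flip_signK _) (@flip_sign_neq _) (cayley_stepK s).

(* ((i, j), onleft, neg), with i != j *)
Definition move n : finType :=
  ({p : 'I_n * 'I_n | p.1 != p.2} * bool * bool)%type.

(* Replaces s_j by s_j s_i^{+-1}, or by s_i^{+-1} s_j if [onleft]. *)
Definition replace n (s : {ffun 'I_n -> G}) (m : move n) : {ffun 'I_n -> G} :=
  let: (p, onleft, neg) := m in
  let: (i, j) := val p in
  [ffun k => if k == j then
               if onleft then signed neg (s i) * s j else s j * signed neg (s i)
             else s k].

Lemma replaceK n (s : {ffun 'I_n -> G}) m :
  replace (replace s m) (flip_sign m) = s.
Proof.
case: m => [[[[i j] /= neq_ij] onleft] neg]; apply/ffunP => k.
rewrite /flip_sign /= !ffunE eqxx (negPf neq_ij) signedN.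
by have [->|//] := eqVneq k j; case: onleft; rewrite ?mulKg ?mulgK.
Qed.

Lemma replace_in n (s : {ffun 'I_n -> G}) m (H : set G) :
  group_closed (mem H) -> range s `<=` H -> range (replace s m) `<=` H.
Proof.
move=> clH sH; have sHm k : s k \in mem H by apply/mem_set/sH; exists k.
have signedH b k : signed b (s k) \in mem H.
  by case: b; rewrite /signed //; apply: group_closedV.
move=> _ [k _ <-]; apply: set_mem.
case: m => [[[[i j] /= _] onleft] neg]; rewrite /= ffunE.
case: ifP => // _.
by case: onleft; apply: (group_closedM clH).
Qed.

Lemma replace_generates n (s : {ffun 'I_n -> G}) m :
  generates s -> generates (replace s m).
Proof.
rewrite /generates => gens; apply/seteqP; split=> // x _ H [clH sH].
have : generated (range s) x by rewrite gens.
apply; split=> //; rewrite -(replaceK s m); exact: replace_in.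
Qed.

Definition replace_gen n (s : gen_tuple n) (m : move n) : gen_tuple n :=
  Sub (replace (val s) m)
      (introT (asboolP _) (replace_generates m (elimT (asboolP _) (valP s)))).

Lemma replace_genK n (s : gen_tuple n) m :
  replace_gen (replace_gen s m) (flip_sign m) = s.
Proof. by apply: val_inj; exact: replaceK. Qed.

Definition product_replacement n : multigraph :=
  labelled_graph (@flip_signK _) (@flip_sign_neq _) (@replace_genK n).

End Generation.

Definition uniformly_nonamenable (R : realType) (G : groupType)
    (fgG : finitely_generated G) : Prop :=
  forall n : nat, (min_gens fgG <= n)%N ->
    exists2 c : R, (0 < c)%R &
      (c < inf [set cheeger R (cayley (val S)) | S in [set: gen_tuple G n]])%R.

(* Main.v *)
Require Import Defs.
From mathcomp Require Import all_boot all_algebra reals.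
From mathcomp Require Import all_order finmap boolp classical_sets cardinality.
From mathcomp Require Import zify lra.

Set Implicit Arguments.
Unset Strict Implicit.
Unset Printing Implicit Defensive.

Import Order.TTheory GRing.Theory Num.Theory.

(** Let G act on generating n-tuples by conjugation.  The orbit map g |-> g.S of
    a generating tuple S identifies two group elements exactly when they differ
    by a central element, because an element that commutes with all entries of S
    commutes with G.  Moreover, right multiplication of g by an entry s_i of S
    corresponds to conjugating the tuple g.S by its own i-th entry, since
    (g s_i).S is the conjugate of g.S by g s_i g^-1 ([conj_cayley_step]).  Hence
    the tuples, joined by the moves that conjugate a tuple by one of its own
    entries or the inverse of one, fall into components that are the Cayley
    graphs of G / Z(G) with respect to generating n-tuples.

    Passing from G to G / Z(G) preserves isoperimetry, as Z(G) is amenable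
    ([isoperimetry_central_quotient]): a finite set of cosets with small boundary
    lifts to G, thickened by a Følner set of Z(G), to a finite set with small
    boundary.  The Følner sets come from polynomial growth in abelian groups
    ([abelian_folner]).  So uniform non-amenability bounds the isoperimetry of
    all components below by one constant, which therefore also works for finite
    sets meeting several components ([isoperimetry_classes]).

    Finally, conjugating a tuple by its i-th entry is a product of at most 2n
    edges of the product replacement graph: for each j other than i, multiply
    s_j on the left by s_i and on the right by its inverse
    ([conj_step_word]).  A conjugation move that leaves a finite set must leave
    it along one of these edges, so the isoperimetric inequality descends to the
    product replacement graph up to a factor of order n^2.

    The boundary of a finite set X is counted direction by direction, through the
    number [escape X f] of points of X that a map f sends outside X.

    For n <= 1 there are no replacement moves; the same argument then shows
    that the hypothesis on G cannot hold. *)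

(** * Escape counts *)

Section Escape.
Variable V : choiceType.
Implicit Types (X : {fset V}) (f g : V -> V).

Definition escape X f : nat := count (fun v => f v \notin X) X.

(** A point of X that leaves X under the composite either leaves under f, or is
    sent by f to a point of X that leaves under g; injectivity of f ensures that
    each such point of X is counted once. *)
Lemma escape_comp X f g : injective f ->
  (escape X (g \o f) <= escape X f + escape X g)%N.
Proof.
move=> injf.
pose fX := [seq u <- map f X | (u \in X) && (g u \notin X)].
have fXle : (size fX <= escape X g)%N.
  rewrite /escape -size_filter; apply: uniq_leq_size.
    by rewrite filter_uniq // map_inj_uniq.
  by move=> u; rewrite !mem_filter => /andP[/andP[-> ->]].
apply: leq_trans (_ : _ <= escape X f + size fX)%N _; last by rewrite leq_add2l.
rewrite size_filter count_map -count_predUI.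
apply: leq_trans (leq_addr _ _); apply: sub_count => v /=.
by case: (f v \in X).
Qed.

Lemma escape_foldl (L : Type) (step : V -> L -> V) X (b : nat) (w : seq L) :
    (forall l, injective (step^~ l)) ->
    (forall l, escape X (step^~ l) <= b)%N ->
  (escape X (fun v => foldl step v w) <= size w * b)%N.
Proof.
move=> injs leb; elim: w => [|l w IHw] /=.
  by rewrite leqn0 /escape eqn0Ngt -has_count; apply/hasPn => v vX; rewrite negbK.
apply: leq_trans (escape_comp X (fun v => foldl step v w) (injs l)) _.
by rewrite mulSn leq_add.
Qed.

Lemma escape_split X f (p : pred V) : (forall v, p (f v) = p v) ->
  escape X f = (escape [fset v in X | p v]%fset f
                + escape [fset v in X | ~~ p v]%fset f)%N.
Proof.
move=> pf; rewrite /escape.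
have splitX (q : pred V) : count q X =
    (count q [fset v in X | p v]%fset + count q [fset v in X | ~~ p v]%fset)%N.
  rewrite -count_cat; apply/permP/uniq_perm => //.
    rewrite cat_uniq !fset_uniq andbT /=.
    by apply/hasPn => v; rewrite !inE /= => /andP[_ /negPf->]; rewrite andbF.
  by move=> v; rewrite mem_cat !inE /=; case: (p v); rewrite /= ?andbT ?andbF ?orbF.
rewrite splitX; congr addn; apply: eq_in_count => v; rewrite !inE /= pf.
  by case/andP => _ ->; rewrite andbT.
by case/andP => _ ->; rewrite andbT.
Qed.

(** A step never changes the class e s, so X can be cut into its trace on the
    class of a point and the rest, without creating or losing boundary; the
    inequality adds up over the pieces. *)
Lemma isoperimetry_classes (R : realType) (L : finType) (step : V -> L -> V)
    (e : rel V) (a : R) X :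
    (forall s, e s s) -> (forall s v l, e s (step v l) = e s v) ->
    (forall s (A : {fset V}), s \in X -> {subset A <= X} -> {in A, forall v, e s v} ->
      (a * #|` A|%:R <= (\sum_l escape A (step^~ l))%:R)%R) ->
  (a * #|` X|%:R <= (\sum_l escape X (step^~ l))%:R)%R.
Proof.
move=> ee estep; have [k leXk] := ubnP #|` X|.
elim: k => // k IHk in X leXk * => isoA.
have [->|[s sX]] := fset_0Vmem X; first by rewrite cardfs0 mulr0 ler0n.
under eq_bigr do rewrite (escape_split _ (fun v => estep s v _)).
set A := [fset v in X | e s v]%fset; set B := [fset v in X | ~~ e s v]%fset.
have AX : {subset A <= X} by move=> v; rewrite !inE /= => /andP[].
have BX : {subset B <= X} by move=> v; rewrite !inE /= => /andP[].
have cardX : #|` X| = (#|` A| + #|` B|)%N.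
  have -> : A = (X `&` A)%fset by apply/fsetP => v; rewrite !inE /= andbA andbb.
  have -> : B = (X `\` A)%fset.
    by apply/fsetP => v; rewrite !inE /= negb_and andb_orl andNb /= andbC.
  by rewrite cardfsID.
have A_gt0 : (0 < #|` A|)%N.
  by rewrite cardfs_gt0; apply/fset0Pn; exists s; rewrite !inE /= sX ee.
rewrite big_split /= !natrD cardX natrD mulrDr lerD //.
  by apply: (isoA s) => // v; rewrite !inE /= => /andP[].
apply: IHk => [|t C tB CB eC]; first by move: leXk; rewrite cardX; lia.
by apply: (isoA t) => //; [exact: BX | move=> v /CB/BX].
Qed.

End Escape.

Lemma escape_image (U V : choiceType) (h : U -> V) (X : {fset U}) f f' :
  injective h -> (forall u, h (f u) = f' (h u)) ->
  escape [fset h u | u in X]%fset f' = escape X f.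
Proof.
move=> injh hf; rewrite /escape.
have /permP-> : perm_eq [fset h u | u in X]%fset (map h X).
  apply: uniq_perm; rewrite ?fset_uniq ?map_inj_uniq ?fset_uniq // => v.
  by apply/imfsetP/mapP => [[u uX ->]|[u uX ->]]; exists u.
rewrite count_map; apply: eq_count => u /=.
by rewrite -hf mem_imfset.
Qed.

(** This turns the Cheeger constants of Cayley and product replacement graphs
    into statements on escape counts, where moves can be composed. *)
Lemma card_boundary (V : choiceType) (L : finType) (step : V -> L -> V)
    (linv : L -> L) (linvK : involutive linv) (linv_neq : forall l, linv l != l)
    (stepK : forall v l, step (step v l) (linv l) = v)
    (X : {fset vertex (labelled_graph linvK linv_neq stepK)}) :
  #|` fset_set (boundary X)| = \sum_l escape (X : {fset V}) (step^~ l).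
Proof.
pose D := [seq e <- [seq (v, l) | v <- enum_fset X, l <- enum L]
            | step e.1 e.2 \notin X].
have -> : #|` fset_set (boundary X)| = size D.
  apply/perm_size/uniq_perm; first exact: fset_uniq.
    by rewrite filter_uniq // allpairs_uniq ?fset_uniq ?enum_uniq // => -[? ?] [? ?].
  move=> [v l]; rewrite in_fset_set; last exact: boundary_finite.
  rewrite mem_filter; apply/idP/idP => [|/andP[/= out /allpairsP[[u m] /= [uX _ [vu _]]]]].
    move=> /set_mem[/= vX out]; rewrite out /=.
    by apply/allpairsP; exists (v, l); rewrite mem_enum.
  by rewrite inE; split=> //=; rewrite vu.
rewrite size_filter -sum1_count big_mkcond big_allpairs /= exchange_big /=.
rewrite big_enum; apply: eq_bigr => l _.
by rewrite -big_mkcond sum1_count.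
Qed.

(** * Følner sets in abelian groups *)

(** With k = j (m + 1), Bernoulli's inequality gives
    (1 + eps)^k >= (j eps)^(m + 1), of degree m + 1 in j, against degree m. *)
Lemma exp_gt_polynomial (R : realType) (eps : R) (m : nat) : (0 < eps)%R ->
  exists k : nat, (k.+1%:R ^+ m < (1 + eps) ^+ k :> R)%R.
Proof.
move=> eps_gt0.
have bernoulli j : (j%:R * eps <= (1 + eps) ^+ j :> R)%R.
  suff : (1 + j%:R * eps <= (1 + eps) ^+ j :> R)%R by lra.
  elim: j => [|j IHj]; first by rewrite expr0; lra.
  have jge0 : (0 <= j%:R :> R)%R by rewrite ler0n.
  by rewrite exprS -natr1; nra.
pose C : R := (m.+2%:R ^+ m / eps ^+ m.+1)%R.
pose j := (Num.trunc C).+1.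
have Cj : (C < j%:R)%R by exact: truncnS_gt.
exists (j * m.+1)%N; rewrite exprM.
apply: lt_le_trans (_ : (j%:R * eps) ^+ m.+1 <= _)%R; last first.
  by rewrite lerXn2r ?nnegrE ?exprn_ge0 ?mulr_ge0 ?ler0n //; lra.
apply: le_lt_trans (_ : (j * m.+2)%:R ^+ m < _)%R.
  rewrite lerXn2r ?nnegrE ?ler0n // ler_nat; rewrite /j; lia.
rewrite natrM exprMn exprMn [X in (_ < X * _)%R]exprSr -mulrA ltr_pM2l; last first.
  by rewrite exprn_gt0 // ltr0n.
by rewrite -ltr_pdivrMr // exprn_gt0.
Qed.

Section Folner.
Variable G : groupType.
Local Open Scope group_scope.

(** The products of powers of the elements of T, with exponents below k: the
    images in the group of the boxes of Z^m, where m is the size of T. *)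
Fixpoint power_box (T : seq G) (k : nat) : seq G :=
  if T is t :: T' then [seq t ^+ i * x | i <- iota 0 k, x <- power_box T' k]
  else [:: 1].

Lemma size_power_box T k : size (power_box T k) = (k ^ size T)%N.
Proof. by elim: T => //= t T IHT; rewrite size_allpairs size_iota IHT expnS. Qed.

Lemma power_box_consP t T k f :
  reflect (exists i x, [/\ (i < k)%N, x \in power_box T k & f = t ^+ i * x])
          (f \in power_box (t :: T) k).
Proof.
apply: (iffP allpairsP) => [[[i x] /= [ik xT ->]]|[i [x [ik xT ->]]]].
  by exists i, x; split=> //; move: ik; rewrite mem_iota.
by exists (i, x); rewrite mem_iota.
Qed.

Lemma power_box_commute T k x f : {in T, forall t, commute x t} ->
  f \in power_box T k -> commute x f.
Proof.
elim: T f => [|t T IHT] f xT.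
  by rewrite mem_seq1 => /eqP->; exact: commute1.
case/power_box_consP => i [g [_ gT ->]]; apply: commuteM.
  by apply/commuteX/xT/mem_head.
by apply: IHT => // u uT; apply: xT; rewrite inE uT orbT.
Qed.

Lemma power_box_sub T k : {subset power_box T k <= power_box T k.+1}.
Proof.
elim: T => // t T IHT f /power_box_consP[i [g [ik gT ->]]].
by apply/power_box_consP; exists i, g; split=> //; [exact: ltnW | exact: IHT].
Qed.

Lemma power_box_mul T k t f : {in T &, forall t u, commute t u} -> t \in T ->
  f \in power_box T k -> t * f \in power_box T k.+1.
Proof.
elim: T f => // u T IHT f cT tuT /power_box_consP[i [g [ik gT ->]]].
apply/power_box_consP; have [->|neq_tu] := eqVneq t u.
  by exists i.+1, g; split=> //; [exact: power_box_sub | rewrite expgS mulgA].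
have tT : t \in T by move: tuT; rewrite inE (negPf neq_tu).
exists i, (t * g); split; first exact: ltnW.
  by apply: IHT => // x y xT yT; apply: cT; rewrite inE ?xT ?yT orbT.
rewrite !mulgA; congr (_ * _); apply: commuteX.
by apply: cT; rewrite inE ?tT ?eqxx ?orbT.
Qed.

(** If no box F k were good, each would have some t in T that moves a proportion
    eps of it outside.  As t F k is contained in the next box, the sizes of the
    boxes would grow exponentially, while they are at most (k + 1)^m for T of size
    m, by [size_power_box].  The second
    clause makes F central as soon as T is. *)
Lemma abelian_folner (R : realType) (T : seq G) (eps : R) :
    {in T &, forall t u, commute t u} -> (0 < eps)%R ->
  exists F : {fset G}, [/\ F != fset0%fset,
    forall x f, {in T, forall t, commute x t} -> f \in F -> commute x f &
    {in T, forall t, ((escape F (fun f => t * f)%g)%:R <= eps * #|` F|%:R)%R}].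
Proof.
move=> cT eps_gt0; pose F k : {fset G} := [fset x in power_box T k.+1]%fset.
have inF k x : (x \in F k) = (x \in power_box T k.+1) by rewrite !inE.
have F0 k : F k != fset0%fset.
  apply/fset0Pn; exists 1; rewrite inF.
  elim: (T) => [|t T' IHT]; first by rewrite mem_head.
  by apply/power_box_consP; exists 0%N, 1; rewrite mulg1.
apply: contrapT => noF.
(* the box F k and the part of t F k outside it are disjoint in F k.+1 *)
have growth k : ((1 + eps) * #|` F k|%:R <= #|` F k.+1|%:R :> R)%R.
  have [t tT esc_t] : exists2 t, t \in T &
      (eps * #|` F k|%:R < (escape (F k) (fun f => t * f)%g)%:R)%R.
    apply: contrapT => no_t; apply: noF; exists (F k); split=> //.
      by move=> x f xT; rewrite inF; exact: power_box_commute.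
    move=> t tT; rewrite leNgt; apply/negP => lt_t.
    by apply: no_t; exists t.
  suff : (#|` F k| + escape (F k) (fun f => t * f)%g <= #|` F k.+1|)%N.
    by rewrite -(ler_nat R) natrD; lra.
  rewrite /escape -(count_map (fun f => t * f)%g (fun x => x \notin F k)) -size_filter -size_cat.
  apply: uniq_leq_size.
    rewrite cat_uniq fset_uniq filter_uniq ?map_inj_uniq ?fset_uniq ?andbT //=.
      by apply/hasPn => x; rewrite mem_filter => /andP[].
    exact: mulgI.
  move=> x; rewrite mem_cat mem_filter inF => /orP[/[!inF]|/andP[_ /mapP[f /[!inF] fF ->]]].
    exact: power_box_sub.
  exact: power_box_mul.
have lowerF k : ((1 + eps) ^+ k <= #|` F k|%:R :> R)%R.
  elim: k => [|k IHk]; first by rewrite expr0 ler1n cardfs_gt0.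
  by apply: le_trans (growth k); rewrite exprS ler_pM2l // addr_gt0.
have upperF k : (#|` F k| <= k.+1 ^ size T)%N.
  by rewrite -size_power_box card_fseq size_undup.
have [k] := exp_gt_polynomial (size T) eps_gt0; apply/negP; rewrite -leNgt.
by apply: le_trans (lowerF k) _; rewrite -natrX ler_nat.
Qed.

End Folner.

(** * Quotients by the center *)

Section CentralQuotient.
Variables (R : realType) (G : groupType) (V : choiceType) (L : finType).
Variables (gs : L -> G) (phi : G -> V) (step : V -> L -> V).
Local Open Scope group_scope.
Hypothesis phi_step : forall g l, phi (g * gs l) = step (phi g) l.
Hypothesis phi_fiber : forall g h,
  phi g = phi h <-> forall x, commute x (h^-1 * g).

(** Here phi makes V a quotient of G by its center, and step is the graph induced
    on V by the generators gs.  For a section sec of phi over A, a step inside A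
    from v to v' reads sec v * gs l = sec v' * z with z = z v l central.  Let F be a
    Følner set for these finitely many z, and W the set of products sec v * f with
    f in F.  The map (v, f) |-> sec v * f is injective on A x F, and a point of W
    above v leaves W only if v leaves A, or if z f leaves F.  So the boundary of W
    is at most |F| times that of A, plus a proportion eps #|L| of |W|; as eps was
    chosen so that eps #|L| <= c / 2, half of the constant c survives. *)
Lemma isoperimetry_central_quotient (c : R) : (0 < c)%R ->
    (forall W : {fset G},
      (c * #|` W|%:R <= (\sum_l escape W (fun g => g * gs l)%g)%:R)%R) ->
  forall A : {fset V}, {in A, forall v, exists g, phi g = v} ->
    (c / 2 * #|` A|%:R <= (\sum_l escape A (step^~ l))%:R)%R.
Proof.
move=> c_gt0 isoG A phiA.
have [sec secK] : exists sec : V -> G, {in A, forall v, phi (sec v) = v}.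
  have /choice[sec secK] v : exists g, v \in A -> phi g = v.
    by case: (boolP (v \in A)) => [/phiA[g]|_]; [exists g | exists 1].
  by exists sec => v; exact: secK.
pose z v l := if step v l \in A then (sec (step v l))^-1 * (sec v * gs l) else 1.
have z_central v l x : v \in A -> commute x (z v l).
  rewrite /z => vA; case: ifP => [slA|_]; last exact: commute1.
  by apply: (phi_fiber _ _).1; rewrite phi_step !secK.
pose T := [seq z v l | v <- enum_fset A, l <- enum L].
have T_central x : {in T, forall t, commute x t}.
  by move=> _ /allpairsP[[v l] /= [vA _ ->]]; exact: z_central.
pose eps : R := (c / 2 / #|L|.+1%:R)%R.
have eps_gt0 : (0 < eps)%R by rewrite !divr_gt0 ?ltr0n.
have [F [F0 F_comm F_folner]] :=
  abelian_folner (fun x y _ yT => T_central x y yT) eps_gt0.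
have F_central x f : f \in F -> commute x f by apply/F_comm/T_central.
have F_gt0 : (0 < #|` F|%:R :> R)%R by rewrite ltr0n cardfs_gt0.
have phiF g f : f \in F -> phi (g * f) = phi g.
  by move=> fF; apply/phi_fiber => x; rewrite mulKg; exact: F_central.
pose AF := [seq sec v * f | v <- enum_fset A, f <- enum_fset F].
pose W : {fset G} := [fset x in AF]%fset.
have AF_uniq : uniq AF.
  apply: allpairs_uniq; rewrite ?fset_uniq // => -[v f] [u h] /allpairsP[[? ?] /= [vA fF [-> ->]]].
  move=> /allpairsP[[? ?] /= [uA hF [-> ->]]] /= eq_vf.
  have eq_vu := congr1 phi eq_vf; rewrite !phiF ?secK // in eq_vu.
  by move: eq_vf; rewrite eq_vu => /mulgI->.
have W_AF : perm_eq W AF.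
  by apply: uniq_perm; rewrite ?fset_uniq // => x; rewrite !inE.
have cardW : #|` W| = (#|` A| * #|` F|)%N.
  by rewrite (perm_size W_AF) size_allpairs.
(* the points of W above v that leave W in direction l *)
have fiber_escape v l : v \in A ->
    ((count (fun f => sec v * f * gs l \notin W)%g F)%:R
      <= (step v l \notin A)%:R * #|` F|%:R + eps * #|` F|%:R :> R)%R.
  move=> vA; have [slA|slA] /= := boolP (step v l \in A); last first.
    by rewrite mul1r; apply: ler_wpDr; [rewrite mulr_ge0 ?ltW | rewrite ler_nat count_size].
  rewrite mul0r add0r; apply: le_trans (F_folner (z v l) _); last first.
    by apply/allpairsP; exists (v, l); rewrite mem_enum.
  rewrite ler_nat /escape -!size_filter; apply: uniq_leq_size.
    by rewrite filter_uniq ?fset_uniq.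
  move=> f; rewrite !mem_filter => /andP[/= + fF]; rewrite fF andbT.
  apply: contra => zfF.
  rewrite !inE /=; apply/allpairsP; exists (step v l, z v l * f); split=> //=.
  rewrite /z slA -(mulgA (sec v)) -(F_central (gs l) f fF).
  by rewrite !mulgA mulgV mul1g.
have := isoG W; rewrite cardW natrM => isoW.
suff escW l : ((escape W (fun g => g * gs l)%g)%:R
    <= (escape A (step^~ l))%:R * #|` F|%:R + #|` A|%:R * (eps * #|` F|%:R) :> R)%R.
  have epsL : (#|L|%:R * eps <= c / 2)%R.
    rewrite /eps mulrA ler_pdivrMr ?ltr0n // mulrC.
    by rewrite ler_wpM2l ?ler_nat // divr_ge0 // ltW.
  rewrite -(ler_pM2r F_gt0) natr_sum mulr_suml.
  have : (c * (#|` A|%:R * #|` F|%:R) <=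
      \sum_l (escape A (step^~ l))%:R * #|` F|%:R
      + #|L|%:R * (#|` A|%:R * (eps * #|` F|%:R)))%R.
    apply: le_trans isoW _; rewrite natr_sum.
    apply: le_trans (ler_sum _ (fun l _ => escW l)) _.
    by rewrite big_split /= sumr_const [(#|L|%:R * _)%R]mulr_natl.
  have AF_ge0 : (0 <= #|` A|%:R * #|` F|%:R :> R)%R by rewrite mulr_ge0 ?ler0n.
  have := ler_wpM2r AF_ge0 epsL.
  lra.
have -> : escape W (fun g => g * gs l)%g =
    \sum_(v <- enum_fset A) count (fun f => sec v * f * gs l \notin W)%g F.
  rewrite /escape; move/permP: W_AF => ->.
  rewrite -sum1_count big_mkcond big_allpairs_dep /=; apply: eq_bigr => v _.
  by rewrite -big_mkcond sum1_count.
rewrite natr_sum /escape -sum1_count natr_sum mulr_suml.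
have -> (x : R) : (#|` A|%:R * x = \sum_(v <- enum_fset A) x)%R.
  by rewrite big_const_seq count_predT iter_addr_0 mulr_natl.
rewrite [X in (_ <= X + _)%R]big_mkcond -big_split /= big_seq [leRHS]big_seq.
apply: ler_sum => v /fiber_escape/le_trans; apply.
by case: (step v l \in A); rewrite /= ?mul0r.
Qed.

End CentralQuotient.

(** * Conjugation of generating tuples *)

Section Conjugation.
Variables (G : groupType) (n : nat).
Implicit Types (s : {ffun 'I_n -> G}) (g h x : G).
Local Open Scope group_scope.

Definition conj_tuple g s : {ffun 'I_n -> G} := [ffun k => g * s k * g^-1].

Lemma conj_tuple1 s : conj_tuple 1 s = s.
Proof. by apply/ffunP => k; rewrite ffunE mul1g invg1 mulg1. Qed.

Lemma conj_tupleM g h s : conj_tuple (g * h) s = conj_tuple g (conj_tuple h s).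
Proof. by apply/ffunP => k; rewrite !ffunE invgM !mulgA. Qed.

Lemma conj_tupleK g s : conj_tuple g^-1 (conj_tuple g s) = s.
Proof. by rewrite -conj_tupleM mulVg conj_tuple1. Qed.

Definition conj_step s (l : 'I_n * bool) := conj_tuple (signed l.2 (s l.1)) s.

(** The i-th entry of the conjugate of s by g is g s_i g^-1, and
    (g s_i g^-1) g = g s_i. *)
Lemma conj_cayley_step s g l :
  conj_tuple (cayley_step s g l) s = conj_step (conj_tuple g s) l.
Proof.
rewrite /conj_step -conj_tupleM ffunE; congr conj_tuple.
rewrite /cayley_step; case: l.2; rewrite /signed.
  by rewrite !invgM invgK -!mulgA mulVg mulg1.
by rewrite -!mulgA mulVg mulg1.
Qed.

Lemma commute_generates s x : generates s ->
  (forall k, commute x (s k)) -> forall y, commute x y.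
Proof.
move=> gen_s xs y; have : generated (range s) y by rewrite gen_s.
apply: (_ : _ -> [set y | commute x y]%classic y); apply; split; last first.
  by move=> _ [k _ <-]; exact: xs.
split=> [|a b /set_mem /= xa /set_mem /= xb]; apply: mem_set => /=.
  exact: commute1.
by apply: commuteM => //; exact: commuteV.
Qed.

Lemma conj_tuple_fiber s g h : generates s ->
  conj_tuple g s = conj_tuple h s <-> forall x, commute x (h^-1 * g).
Proof.
move=> gen_s; split=> [eq_gh x|hg].
  apply: commute_sym; apply: (commute_generates gen_s) => k.
  have /ffunP/(_ k) := congr1 (conj_tuple h^-1) eq_gh.
  rewrite conj_tupleK -conj_tupleM ffunE => eq_k.
  by rewrite /commute -[in RHS]eq_k mulgVK.
rewrite -[g](mulVKg h) conj_tupleM; congr conj_tuple.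
by apply/ffunP => k; rewrite ffunE -hg mulgK.
Qed.

Lemma replace_inj (m : move n) : injective ((@replace G n)^~ m).
Proof. by move=> s t eq_st; rewrite -(replaceK s m) eq_st replaceK. Qed.

(** Left multiplication by the i-th entry followed by right multiplication by its
    inverse conjugates one entry.  The i-th entry itself never changes, so the
    entries of js can be treated one after the other with the same
    conjugator. *)
Lemma conj_entries_word (i : 'I_n) b (js : seq 'I_n) : uniq js -> i \notin js ->
  exists2 w : seq (move n), size w = (2 * size js)%N &
    forall s, foldl (@replace G n) s w = [ffun k =>
      if k \in js then signed b (s i) * s k * (signed b (s i))^-1 else s k].
Proof.
elim: js => [_ _|j js IHjs] /=.
  by exists [::] => // s; apply/ffunP => k; rewrite ffunE.
case/andP => j_js uniq_js; rewrite inE negb_or => /andP[neq_ij i_js].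
have [w size_w wE] := IHjs uniq_js i_js.
pose ij : {p : 'I_n * 'I_n | p.1 != p.2} := Sub (i, j) neq_ij.
exists [:: (ij, true, b), (ij, false, ~~ b) & w].
  by rewrite /= size_w mulnS.
move=> s; rewrite /= wE; apply/ffunP => k; rewrite !ffunE /= inE eqxx.
rewrite (negPf neq_ij); have [->|neq_kj] := eqVneq k j; last by [].
by rewrite (negPf j_js) signedN.
Qed.

(** The i-th entry commutes with itself, so it is enough to conjugate the others. *)
Lemma conj_step_word (l : 'I_n * bool) : exists2 w : seq (move n),
  (size w <= 2 * n)%N & forall s, conj_step s l = foldl (@replace G n) s w.
Proof.
case: l => i b; pose js := rem i (enum 'I_n).
have in_js k : (k \in js) = (k != i).
  by rewrite mem_rem_uniq ?enum_uniq // !inE mem_enum andbT.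
have [||w size_w wE] := @conj_entries_word i b js.
- by rewrite rem_uniq ?enum_uniq.
- by rewrite in_js eqxx.
exists w => [|s].
  by rewrite size_w leq_mul2l size_rem ?mem_enum // size_enum_ord leq_pred.
rewrite wE; apply/ffunP => k; rewrite !ffunE /= in_js.
have [->|//] := eqVneq k i.
by case: b {w size_w wE} => /=; rewrite ?invgK ?mulVg ?mul1g ?mulgK.
Qed.

End Conjugation.

(** * Cheeger constants *)

Section Cheeger.
Variable R : realType.
Implicit Type Gam : multigraph.
Local Open Scope ring_scope.

Lemma cheeger_le Gam (X : {fset vertex Gam}) :
  cheeger R Gam * #|` X|%:R <= #|` fset_set (boundary X)|%:R.
Proof.
have [->|X0] := eqVneq X fset0%fset; first by rewrite cardfs0 mulr0.
rewrite -ler_pdivlMr ?ltr0n ?cardfs_gt0 //; apply: ge_inf; last by exists X.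
by exists 0 => _ [Y _ <-]; rewrite divr_ge0.
Qed.

(** The vertex v matters because the infimum defining [cheeger] is 0 on an empty
    graph. *)
Lemma cheeger_ge Gam (a : R) (v : vertex Gam) :
  (forall X : {fset vertex Gam}, a * #|` X|%:R <= #|` fset_set (boundary X)|%:R) ->
  a <= cheeger R Gam.
Proof.
move=> isoX; apply: lb_le_inf.
  exists (#|` fset_set (boundary [fset v]%fset)|%:R / #|` [fset v]%fset|%:R), [fset v]%fset => //=.
  by apply/fset0Pn; exists v; rewrite inE.
by move=> _ [X X0 <-]; rewrite ler_pdivlMr ?ltr0n ?cardfs_gt0.
Qed.

End Cheeger.

Section ProductReplacement.
Variables (R : realType) (G : groupType) (n : nat) (c : R).
Hypothesis c_gt0 : (0 < c)%R.
Hypothesis cayley_ge : forall s : {ffun 'I_n -> G}, generates s ->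
  (c <= cheeger R (cayley s))%R.

(** Cut X along conjugacy classes of tuples; on the class of s, the conjugation
    steps form the quotient by the center of the Cayley graph of s. *)
Lemma isoperimetry_conj_step (X : {fset {ffun 'I_n -> G}}) :
    {in X, forall s, generates s} ->
  (c / 2 * #|` X|%:R <= (\sum_l escape X ((@conj_step G n)^~ l))%:R)%R.
Proof.
move=> genX.
pose conjugate (s v : {ffun 'I_n -> G}) := `[< exists g : G, v = conj_tuple g s >].
apply: (@isoperimetry_classes _ R _ (@conj_step G n) conjugate) => [s|s v l|s A sX AX conjA].
- by apply/asboolP; exists 1%g; rewrite conj_tuple1.
- apply/asboolP/asboolP => -[g vE].
    exists ((signed l.2 (v l.1))^-1 * g)%g.
    by rewrite conj_tupleM -vE conj_tupleK.
  by exists (signed l.2 (v l.1) * g)%g; rewrite conj_tupleM -vE.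
apply: (@isoperimetry_central_quotient R G _ _ (fun l => signed l.2 (s l.1))
          (fun g => conj_tuple g s)) => //.
- by move=> g l; exact: conj_cayley_step.
- by move=> g h; apply: conj_tuple_fiber; exact: genX.
- move=> W; have := cheeger_le R (W : {fset vertex (cayley s)}).
  rewrite card_boundary; apply: le_trans.
  by rewrite ler_wpM2r // cayley_ge //; exact: genX.
- by move=> v /conjA/asboolP[g ->]; exists g.
Qed.

(** Each of the 2n conjugation steps is a word of at most 2n moves, and each move
    accounts for at most the whole boundary: hence 4 n^2.  The successor in the
    denominator keeps it positive when n = 0. *)
Lemma product_replacement_isoperimetry
    (X : {fset vertex (product_replacement G n)}) :
  (c / 2 / (4 * n ^ 2).+1%:R * #|` X|%:R <= #|` fset_set (boundary X)|%:R)%R.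
Proof.
pose Y : {fset {ffun 'I_n -> G}} := [fset val s | s in (X : {fset gen_tuple G n})]%fset.
have cardY : #|` Y| = #|` X| by rewrite card_imfset //; exact: val_inj.
set b := #|` fset_set (boundary X)|.
have replace_le (m : move n) : (escape Y ((@replace G n)^~ m) <= b)%N.
  rewrite (@escape_image _ _ _ X ((@replace_gen G n)^~ m)) //; last exact: val_inj.
  by rewrite /b card_boundary (bigD1 m) //= leq_addr.
have conj_le l : (escape Y ((@conj_step G n)^~ l) <= 2 * n * b)%N.
  have [w size_w wE] := conj_step_word G l.
  rewrite /escape (eq_count (a2 := fun s => foldl (@replace G n) s w \notin Y)).
    apply: leq_trans (escape_foldl w (@replace_inj G n) replace_le) _.
    by rewrite leq_mul2r size_w orbT.
  by move=> s; rewrite /= wE.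
have sum_le : (\sum_l escape Y ((@conj_step G n)^~ l) <= 4 * n ^ 2 * b)%N.
  apply: leq_trans (leq_sum _ (fun l _ => conj_le l)) _.
  by rewrite sum_nat_const card_prod card_ord card_bool; nia.
have genY : {in Y, forall s, generates s}.
  by move=> _ /imfsetP[s _ ->]; apply/asboolP/(valP s).
have := isoperimetry_conj_step genY; rewrite cardY => iso.
rewrite mulrAC ler_pdivrMr ?ltr0n //; apply: le_trans iso _.
by rewrite -natrM ler_nat mulnC; apply: leq_trans sum_le _; rewrite leq_mul2r leqnSn orbT.
Qed.

End ProductReplacement.

Theorem theorem1p2 (R : realType) (G : groupType)
    (fgG : finitely_generated G) :
  uniformly_nonamenable R fgG ->
  forall n : nat, (min_gens fgG <= n)%N ->
    nonamenable R (product_replacement G n).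
Proof.
move=> unifG n /unifG[c c_gt0 c_lt].
(* the infimum of the empty set is 0, so c < inf E provides a generating tuple *)
set E := [set cheeger R (cayley (val S)) | S in [set: gen_tuple G n]]%classic in c_lt.
have [_ [S _ _]] : (E !=set0)%classic.
  apply/set0P/eqP => E0; move: c_lt; rewrite E0 inf0.
  by apply/negP; rewrite -leNgt ltW.
have cayley_ge (t : {ffun 'I_n -> G}) : generates t -> (c <= cheeger R (cayley t))%R.
  move=> gen_t; apply: le_trans (ltW c_lt) _; apply: ge_inf.
    exists 0%R => _ [T _ <-].
    by apply: (@cheeger_ge _ (cayley _) _ (1%g : G)) => X; rewrite mul0r.
  by exists (Sub t (introT (asboolP _) gen_t)).
have h_ge := cheeger_ge (S : vertex (product_replacement G n))
  (product_replacement_isoperimetry c_gt0 cayley_ge).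
by apply: lt_le_trans h_ge; rewrite !divr_gt0 ?ltr0n.
Qed.
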